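(* Let $X$ and $Y$ be nonempty metric spaces. The product $X\times Y$ is straight if and only if both $X$ and $Y$ are straight and one of the following conditions holds: (a) both $X$ and $Y$ are precompact; (b) both $X$ and $Y$ are ULC; (c) one of the two spaces is both precompact and ULC.
   Context: All spaces are metric. A metric space $X$ is straight if whenever $X$ is the union of finitely many closed sets, a continuous function $f\colon X\to\mathbb{R}$ is uniformly continuous if and only if its restriction to each of these closed sets is uniformly continuous. A metric space $X$ is uniformly locally connected (ULC) if for every $\varepsilon>0$ there is $\delta>0$ such that any two points of $X$ at distance $<\delta$ lie in a connected subset of $X$ of diameter $<\varepsilon$. Precompact means totally bounded (equivalently, the metric completion is compact). The product $X\times Y$ carries the metric $d((x,y),(x',y'))=d_X(x,x')+d_Y(y,y')$. *)

(* Defs.v *)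
From HB Require Import structures.
From mathcomp Require Import all_boot all_order all_algebra.
From mathcomp Require Import all_classical all_reals.
From mathcomp Require Import ereal topology normedtype.

Set Implicit Arguments.
Unset Strict Implicit.
Unset Printing Implicit Defensive.

Import Order.TTheory GRing.Theory Num.Theory.
Import numFieldNormedType.Exports.

Local Open Scope classical_set_scope.
Local Open Scope ring_scope.

(* The library's metric structure on [X * Y] is the max one; the alias [l1prod]
   carries the sum metric, and its topology and uniformity are the ones induced
   by that metric. *)
Definition l1prod (R : realType) (X Y : metricType R) : Type := (X * Y)%type.

Section l1prod_metric.
Context {R : realType} {X Y : metricType R}.
Implicit Types p q r : l1prod X Y.

Definition l1dist p q : R := mdist p.1 q.1 + mdist p.2 q.2.

Let l1distxx p : l1dist p p = 0.
Proof. by rewrite /l1dist !mdistxx addr0. Qed.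

Let l1dist_positivity p q : l1dist p q = 0 -> p = q.
Proof.
case: p q => [x y] [x' y'] /eqP; rewrite /l1dist paddr_eq0 ?mdist_ge0//=.
by move=> /andP[/eqP/mdist_positivity-> /eqP/mdist_positivity->].
Qed.

Let l1dist_sym p q : l1dist p q = l1dist q p.
Proof. by rewrite /l1dist metric_sym [X in _ + X]metric_sym. Qed.

Let l1dist_triangle q p r : l1dist p r <= l1dist p q + l1dist q r.
Proof. by rewrite /l1dist addrACA lerD// metric_triangle. Qed.

HB.instance Definition _ := Choice.copy (l1prod X Y) (X * Y)%type.
HB.instance Definition _ := isMetric.Build R (l1prod X Y)
  l1distxx l1dist_positivity l1dist_sym l1dist_triangle.

End l1prod_metric.

Section metric_notions.
Context {R : realType}.
Implicit Types X : metricType R.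

(* [sigL A f] is the restriction of [f] to the subspace [set_type A], which
   carries the induced uniformity. *)
Definition straight X : Prop :=
  forall (n : nat) (F : 'I_n -> set X),
    (forall i, closed (F i)) ->
    \bigcup_(i in [set: 'I_n]) F i = [set: X] ->
    forall f : X -> R, continuous f ->
      (unif_continuous f <-> forall i, unif_continuous (sigL (F i) f)).

(* Extended-real valued: [+oo] for unbounded sets and [-oo] for the empty set. *)
Definition diameter X (A : set X) : \bar R :=
  ereal_sup [set (mdist p.1 p.2)%:E | p in A `*` A].

Definition ulc X : Prop :=
  forall e : R, 0 < e -> exists2 d : R, 0 < d &
    forall x y : X, mdist x y < d ->
      exists C : set X,
        [/\ connected C, C x, C y & (diameter C < e%:E)%E].

(* Total boundedness of the whole space; the library's [precompact] (compact
   closure in the ambient space) is a different notion. *)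
Definition totally_bounded X : Prop :=
  forall e : R, 0 < e -> exists2 S : set X, finite_set S &
    [set: X] = \bigcup_(x in S) ball x e.

End metric_notions.

(* Main.v *)
Require Import Defs.
From mathcomp Require Import all_boot all_order all_algebra.
From mathcomp Require Import all_classical all_reals.
From mathcomp Require Import ereal topology normedtype lra.

(** Straightness speaks of functions; the proof runs on an equivalent property
of open sets, [uplaced]: given disjoint open sets U and V and a radius r, a
point of U whose r-ball stays inside the union of U and V keeps a positive
distance, uniform in the point, from V. If this fails for U and V, the distance
to the complement of their union, cut off to 0 outside U, is a continuous
function that is uniformly continuous on the closed sets ~` V and ~` U, which
cover the space, but not on the whole space ([straight_uplaced]). Conversely, if
f is uniformly continuous on each of n closed pieces, then on a small ball its
values lie in n short intervals, so that a large jump of f skips some level t,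
and the sets f < t and f > t split the ball ([uplaced_straight]).

Necessity. If X is not precompact, it contains a uniformly discrete sequence
x_k. Splittings of balls of Y have nothing to do with one another in general,
but copies of them placed over the points x_k are far apart, and their unions
form a single pair U, V in the product ([uplaced_discrete]). So if the product
is straight, close points of Y cannot be split inside a small ball. Then the
quasi-components of balls of Y are open, hence connected, and Y is ULC
([uplaced_prod_ulc]). Using this for both factors leaves exactly the
conditions (a), (b) and (c).

Sufficiency. Under (b), two close points of the product are joined by a
horizontal and a vertical connected slice of small diameter, which cannot leave
U. Under (c), with X precompact and ULC, small connected sets of X move any pair
of points to one of the finitely many fibres over a finite net of X, where
straightness of Y applies.

Under (a), the argument takes place at the points of the completions, which are
represented by their neighbourhood traces, the round Cauchy filters
([ideal_point]). In a straight space each such filter that contains the union of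
U and V contains U or V ([ideal_tight]). The main step is that a locally
constant function with values in nat is bounded near an ideal point: otherwise
the parity of the position in a list of its values would give U and V
contradicting tightness. Consequently a sequence of relatively clopen sets that
is locally finite at the points of the space is also locally finite at its ideal
points ([locally_finite_avoid]). With U and V open in the product, this is used
first along X, at the pairs made of an ideal point of X and a point of Y, and
then along Y, at the pairs of ideal points; the result is tightness of the
product at every pair of ideal points ([ideal_tight_prod]). In a precompact
space every ultrafilter determines an ideal point, so tightness at all of them
gives [uplaced]. *)

Set Implicit Arguments.
Unset Strict Implicit.
Unset Printing Implicit Defensive.

Import Order.TTheory GRing.Theory Num.Theory.
Import numFieldNormedType.Exports.

Local Open Scope classical_set_scope.
Local Open Scope ring_scope.

(** * Metric forms of the topological notions *)

Section metric_basics.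
Context {R : realType}.
Implicit Types X Y : metricType R.

Lemma in_ball X (x y : X) e : ball x e y <-> mdist x y < e.
Proof. by rewrite ballEmdist. Qed.

Lemma nbhs_mdist_ball X (x : X) (A : set X) :
  nbhs x A <-> exists2 e : R, 0 < e & ball x e `<=` A.
Proof. by rewrite nbhs_ballP. Qed.

Lemma open_mdistP X (U : set X) :
  open U <-> forall x, U x -> exists2 e : R, 0 < e & ball x e `<=` U.
Proof.
rewrite openE; split=> UU x Ux; last exact/nbhs_mdist_ball/UU.
exact/nbhs_mdist_ball/UU.
Qed.

Lemma mdist_ball_open X (x : X) e : open (ball x e).
Proof.
apply/open_mdistP => y /in_ball xy; exists (e - mdist x y).
  by rewrite subr_gt0.
move=> z /in_ball yz; apply/in_ball.
by have := metric_triangle x y z; lra.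
Qed.

(** The trace of U on C is also the trace of the closed set ~` V. *)
Lemma connected_open_split X (C U V : set X) (x : X) :
  connected C -> open U -> open V -> U `&` V = set0 -> C `<=` U `|` V ->
  C x -> U x -> C `<=` U.
Proof.
move=> Cc oU oV UV CUV Cx Ux.
suff <- : C `&` U = C by exact: subIsetr.
apply: Cc; [by exists x | by exists U |].
exists (~` V); first exact: open_closedC.
apply/seteqP; split=> y [Cy].
  by move=> Uy; split=> // Vy; have : (U `&` V) y by []; rewrite UV.
by have [] := CUV _ Cy.
Qed.

Lemma unif_continuous_mdistP X (f : X -> R) :
  unif_continuous f <-> forall e : R, 0 < e -> exists2 d : R, 0 < d &
    forall x y, mdist x y < d -> `|f x - f y| < e.
Proof.
rewrite unif_continuousP; split=> H e /H[d d0 Hd]; exists d => //.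
  by move=> x y /in_ball; exact: (Hd (x, y)).
by move=> [x y] /= /in_ball; exact: Hd.
Qed.

Lemma unif_continuous_sigLP X (A : set X) (f : X -> R) :
  unif_continuous (sigL A f) <-> forall e : R, 0 < e -> exists2 d : R, 0 < d &
    forall x y, A x -> A y -> mdist x y < d -> `|f x - f y| < e.
Proof.
rewrite unif_continuousP; split=> H e /H[d d0 Hd]; exists d => //.
  move=> x y Ax Ay /in_ball xy.
  exact: (Hd (SigSub (mem_set Ax), SigSub (mem_set Ay)) xy).
move=> [[x Ax] [y Ay]] /= /in_ball; apply: Hd; exact: set_mem.
Qed.

Lemma diameter_ltP X (A : set X) (e : R) x y :
  (diameter A < e%:E)%E -> A x -> A y -> mdist x y < e.
Proof.
move=> + Ax Ay; rewrite -lte_fin; apply: le_lt_trans.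
by apply: ereal_sup_ubound; exists (x, y).
Qed.

Lemma diameter_le X (A : set X) (e : R) :
  (forall x y, A x -> A y -> mdist x y <= e) -> (diameter A <= e%:E)%E.
Proof.
by move=> H; apply: ge_ereal_sup => _ [[x y] [/= Ax Ay] <-]; rewrite lee_fin H.
Qed.

Lemma l1distE X Y (p q : l1prod X Y) :
  mdist p q = mdist p.1 q.1 + mdist p.2 q.2.
Proof. by []. Qed.

End metric_basics.

(** * Sequences and finite minima *)

Section choice_tools.
Context {R : realType}.

(** Dependent choice in which each term may depend on all the earlier ones. *)
Lemma history_choice (T : Type) (Q : seq T -> T -> Prop) :
  (forall s, exists x, Q s x) -> exists u : nat -> T, forall k, Q (mkseq u k) (u k).
Proof.
move=> /choice[g Qg].
pose h := fix h k := if k is l.+1 then rcons (h l) (g (h l)) else [::].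
exists (g \o h) => k; suff -> : mkseq (g \o h) k = h k by exact: Qg.
by elim: k => // k IH; rewrite mkseqS IH.
Qed.

Lemma finite_pos_bound (I : eqType) (s : seq I) (P : I -> R -> Prop) :
  (forall i a b, a <= b -> P i b -> P i a) ->
  (forall i, i \in s -> exists2 d, 0 < d & P i d) ->
  exists2 d, 0 < d & forall i, i \in s -> P i d.
Proof.
move=> Pdown; elim: s => [|i s IH] Ps; first by exists 1.
have [|d d0 Pd] := IH; first by move=> j js; apply: Ps; rewrite inE js orbT.
have [|e e0 Pe] := Ps i; first by rewrite inE eqxx.
exists (Num.min d e); first by rewrite lt_min d0.
move=> j; rewrite inE => /predU1P[->|js].
  by apply: Pdown Pe; rewrite ge_min lexx orbT.
by apply: Pdown (Pd _ js); rewrite ge_min lexx.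
Qed.

Lemma inv_nat_lt (e : R) : 0 < e ->
  exists k, forall l, (k <= l)%N -> l.+1%:R^-1 < e.
Proof.
move=> e0; have [k _ ke] := near_infty_natSinv_lt (PosNum e0).
by exists k => l kl; exact: ke.
Qed.

End choice_tools.

(** * Straightness in terms of open sets *)

Section uplaced.
Context {R : realType}.
Implicit Types X : metricType R.

(** In terms of the closed cover by A = ~` V and B = ~` U, the complement of the
union of U and V is the intersection of A and B. The property says that A and B
are u-placed: points of A and of B that are far from the intersection of A and B
are far from each other. *)
Definition uplaced X : Prop := forall (U V : set X) (r : R),
  open U -> open V -> U `&` V = set0 -> 0 < r ->
  exists2 d : R, 0 < d & forall x y, U x -> V y ->
    ball x r `<=` U `|` V -> d <= mdist x y.

(** When y lies in the ball, this says that y is outside the quasi-component of x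
in it. *)
Definition locally_split X (r : R) (x y : X) := exists U V : set X,
  [/\ open U, open V & U `&` V = set0] /\ [/\ ball x r `<=` U `|` V, U x & V y].

Lemma open_bigcup_ball X (W : nat -> set X) (x : nat -> X) r :
  (forall k, open (W k)) -> open (\bigcup_k (W k `&` ball (x k) r)).
Proof.
by move=> oW; apply: bigcup_open => k _; apply: openI => //; exact: mdist_ball_open.
Qed.

(** The balls of radius r around the x k are disjoint, so the local splittings,
each cut down to its ball, unite to one pair of disjoint open sets. *)
Lemma uplaced_discrete X (x y : nat -> X) r : uplaced X -> 0 < r ->
  (forall k l, k <> l -> 2 * r <= mdist (x k) (x l)) ->
  (forall k, locally_split r (x k) (y k)) ->
  exists2 d : R, 0 < d & forall k, d <= mdist (x k) (y k).
Proof.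
move=> Xu r0 xsep /choice[U /choice[V UV]].
pose WU := \bigcup_k (U k `&` ball (x k) r).
pose WV := \bigcup_k (V k `&` ball (x k) r).
have oU : open WU by apply: open_bigcup_ball => k; have [[]] := UV k.
have oV : open WV by apply: open_bigcup_ball => k; have [[]] := UV k.
have dis : WU `&` WV = set0.
  apply/seteqP; split=> // z [[k _ [Ukz /in_ball kz]] [l _ [Vlz /in_ball lz]]].
  have [kl|/xsep] := EM (k = l); last first.
    have := metric_triangle (x k) z (x l); rewrite [mdist z _]metric_sym; lra.
  have [[_ _ <-] _] := UV k; split=> //; by rewrite kl.
have [d d0 Hd] := Xu _ _ r oU oV dis r0.
exists (Num.min d r); first by rewrite lt_min d0.
move=> k; rewrite ge_min; have [/in_ball kr|kr] := ltP (mdist (x k) (y k)) r.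
  have [_ [sub Ux Vy]] := UV k.
  rewrite Hd//; [by exists k => //; split=> //; apply/in_ball; rewrite mdistxx
                |by exists k|].
  by move=> z kz; have [Uz|Vz] := sub _ kz; [left|right]; exists k.
by rewrite orbT.
Qed.

(** The test function is f = h on U and 0 elsewhere, where h is the distance to
the complement of the union of U and V, truncated at 1 so that it makes sense
when this complement is empty. *)
Lemma straight_uplaced X : straight X -> uplaced X.
Proof.
move=> Xs U V r oU oV UV r0.
pose E z := [set t : R | t = 1 \/ exists2 w, ~ (U `|` V) w & t = mdist z w].
have E0 z t : E z t -> 0 <= t.
  by case=> [->//|[w _ ->]]; exact: mdist_ge0.
have lbE z : has_lbound (E z) by exists 0 => t; exact: E0.
have neE z : E z !=set0 by exists 1; left.
pose h z := inf (E z).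
have h0 z : 0 <= h z by apply: lb_le_inf => // t; exact: E0.
have hle z w : ~ (U `|` V) w -> h z <= mdist z w.
  by move=> Ww; apply: ge_inf => //; right; exists w.
have hge z : ball z r `<=` U `|` V -> Num.min r 1 <= h z.
  move=> sub; apply: lb_le_inf => // t [->|[w Ww ->]]; rewrite ge_min ?lexx ?orbT//.
  by rewrite leNgt; apply/orP; left; apply/negP => /in_ball/sub.
have hlip z z' : h z <= h z' + mdist z z'.
  rewrite -lerBlDr; apply: lb_le_inf => // t [->|[w Ww ->]]; rewrite lerBlDr.
    apply: (@le_trans _ _ 1); first by apply: ge_inf => //; left.
    by rewrite lerDl mdist_ge0.
  by apply: le_trans (hle z w Ww) _; rewrite addrC; exact: metric_triangle.
have {}hlip z z' : `|h z - h z'| <= mdist z z'.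
  have := hlip z z'; have := hlip z' z; rewrite [mdist z' _]metric_sym => H1 H2.
  by rewrite ler_norml; apply/andP; split; lra.
pose f z := if z \in U then h z else 0.
have fU z : U z -> f z = h z by move=> Uz; rewrite /f (mem_set Uz).
have fN z : ~ U z -> f z = 0 by move=> Uz; rewrite /f (memNset Uz).
have fle z : `|f z| <= h z.
  have [Uz|Uz] := EM (U z); last by rewrite fN// normr0.
  by rewrite fU// ger0_norm.
have fNV z : ~ V z -> f z = h z.
  move=> Vz; have [Uz|Uz] := EM (U z); [exact: fU|rewrite fN//]; apply/eqP.
  by rewrite eq_le h0 -(mdistxx z) hle//; case.
have fcts : continuous f.
  move=> z; apply/cvgrPdist_lt => e e0; apply/nbhs_mdist_ball.
  have [Uz|Uz] := EM (U z).
    have [d d0 dU] := (open_mdistP U).1 oU z Uz.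
    exists (Num.min d e); first by rewrite lt_min d0.
    move=> w /in_ball; rewrite lt_min => /andP[wd we].
    rewrite !fU//; first exact: le_lt_trans (hlip _ _) we.
    exact/dU/in_ball.
  have [Vz|Vz] := EM (V z).
    have [d d0 dV] := (open_mdistP V).1 oV z Vz.
    exists d => // w /dV Vw; rewrite !fN ?subrr ?normr0// => Uw.
    by have : (U `&` V) w by []; rewrite UV.
  exists e => // w /in_ball zw; rewrite (fN z)// sub0r normrN.
  apply: le_lt_trans (fle w) _; apply: le_lt_trans zw; rewrite metric_sym.
  by apply: hle => -[].
pose F (i : 'I_2) := if i == ord0 then ~` V else ~` U.
have Fc i : closed (F i) by rewrite /F; case: ifP => _; exact: open_closedC.
have FX : \bigcup_(i in [set: 'I_2]) F i = [set: X].
  apply/seteqP; split=> // z _; have [Vz|Vz] := EM (V z); last by exists ord0.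
  exists ord_max => //= Uz; by have : (U `&` V) z by []; rewrite UV.
have /unif_continuous_mdistP/(_ (Num.min r 1))[] : unif_continuous f.
  - apply/(Xs 2 F Fc FX f fcts) => i; apply/unif_continuous_sigLP => e e0.
    exists e => // x y; rewrite /F; case: ifP => _.
      by move=> Vx Vy; rewrite !fNV//; exact: le_lt_trans.
    by move=> Ux Uy; rewrite !fN// subrr normr0.
  - by rewrite lt_min r0/=.
move=> d d0 Hd; exists d => // x y Ux Vy sub.
rewrite leNgt; apply/negP => /Hd; rewrite fU// (fN y) ?subr0; last first.
  by move=> Uy; have : (U `&` V) y by []; rewrite UV.
by rewrite ger0_norm// ltNge hge.
Qed.

(** Pigeonhole: two values t j taken on B by points of the same piece would be
closer than eta, and there are more values t j than pieces. *)
Lemma finite_image_gap X (n : nat) (F : 'I_n -> set X) (f : X -> R) (B : set X)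
    (eta : R) (t : 'I_n.+1 -> R) :
  (forall z, B z -> exists i, F i z) ->
  (forall i z w, F i z -> F i w -> B z -> B w -> `|f z - f w| < eta) ->
  (forall j k : 'I_n.+1, (j < k)%N -> t j + eta <= t k) ->
  exists j, forall z, B z -> f z <> t j.
Proof.
move=> BF fF teta; apply: contrapT => H.
have {}H j : exists z, B z /\ f z = t j.
  apply: contrapT => Hj; apply: H; exists j => z Bz fz; apply: Hj; by exists z.
have /choice[p Hp] j : exists p : X * 'I_n, [/\ B p.1, f p.1 = t j & F p.2 p.1].
  by have [z [Bz fz]] := H j; have [i Fi] := BF z Bz; exists (z, i).
suff /leq_card : injective (fun j => (p j).2) by rewrite !card_ord ltnn.
have aux (j k : 'I_n.+1) : (j < k)%N -> (p j).2 <> (p k).2.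
  move=> jk eq; have [Bj fj Fj] := Hp j; have [Bk fk Fk] := Hp k.
  have := fF _ _ _ Fk _ Bk Bj; rewrite -eq => /(_ Fj).
  by rewrite fj fk ltNge; have := teta _ _ jk; have := ler_norm (t k - t j); lra.
move=> j k /= eq; apply/val_inj; case: (ltngtP j k) => // jk.
  by case: (aux _ _ jk).
by case: (aux _ _ jk).
Qed.

End uplaced.

Section uplaced_straight.
Context {R : realType}.
Implicit Types X : metricType R.

(** One half of the uniform continuity estimate; the other half is the same one
with x and y exchanged, so it need not be treated separately. *)
Definition jumps_less X (f : X -> R) (S : set X) (e : R) : Prop :=
  exists2 d : R, 0 < d & forall x y, S x -> mdist x y < d -> f y < f x + e.

Section finite_cover.
Variables (X : metricType R) (n : nat) (F : 'I_n -> set X) (f : X -> R).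
Variables (eta r : R).
Hypotheses (Xu : uplaced X) (fc : continuous f).
Hypothesis FX : \bigcup_(i in [set: 'I_n]) F i = [set: X].
Hypotheses (eta0 : 0 < eta) (r0 : 0 < r).
Hypothesis fF : forall i x y, F i x -> F i y -> mdist x y < 2 * r ->
  `|f x - f y| < eta.

Let open_below (t : R) : open [set z | f z < t].
Proof. exact: ((continuousP f).1 fc _ (@open_lt _ t)). Qed.

Let open_above (t : R) : open [set z | t < f z].
Proof. exact: ((continuousP f).1 fc _ (@open_gt _ t)). Qed.

Let below_above (t : R) : [set z | f z < t] `&` [set z | t < f z] = set0.
Proof. by apply/seteqP; split=> // z [/= ft /lt_trans/(_ ft)]; rewrite ltxx. Qed.

Let ball_gap x (s : R) : exists j : 'I_n.+1, ball x r `<=`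
  [set z | f z < s + eta * j%:R] `|` [set z | s + eta * j%:R < f z].
Proof.
have [||j k jk|j Hj] := @finite_image_gap _ X n F f (ball x r) eta
    (fun j => s + eta * j%:R).
- by move=> z _; have : [set: X] z by []; rewrite -FX => -[i]; exists i.
- move=> i z w Fz Fw /in_ball xz /in_ball xw; apply: (fF Fz Fw).
  have := metric_triangle z x w; rewrite (metric_sym z x); lra.
- by rewrite -addrA lerD2l -{2}[eta]mulr1 -mulrDr natr1 ler_pM2l// ler_nat.
- exists j => // z /Hj /eqP; rewrite neq_lt => /orP[]; by [left|right].
Qed.

(** The levels at which a jump may be cut can be taken in a fixed grid of step
eta. Where f is bounded only finitely many grid points matter, and [uplaced]
applies to each of the corresponding pairs f < t, f > t. *)
Lemma bounded_jumps_less (N : nat) :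
  jumps_less f [set x | `|f x| <= N%:R * eta] (n.+2%:R * eta).
Proof.
(* The grid starts at the lower bound of f and ends n + 2 steps above the upper
   one, beyond the last of the n + 1 levels just above the highest value. *)
pose t (j : nat) := - (N%:R * eta) + eta * j%:R.
have [||d d0 Hd] := @finite_pos_bound R nat (iota 0 (N + N + n.+3)) (fun j d =>
    forall x y, f x < t j -> t j < f y ->
    ball x r `<=` [set z | f z < t j] `|` [set z | t j < f z] -> d <= mdist x y).
- by move=> j a b ab H x y fx fy sub; exact: le_trans (H _ _ fx fy sub).
- by move=> j _; exact: Xu (open_below _) (open_above _) (below_above _) r0.
exists d => // x y /= fxN xyd; rewrite ltNge; apply/negP => fxy.
(* f x lies between the grid points k and k + 1. *)
pose k := Num.trunc (f x / eta + N%:R).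
have /Num.Theory.truncn_itv/andP[] : 0 <= f x / eta + N%:R.
  rewrite -(mulfK (lt0r_neq0 eta0) N%:R) -mulrDl divr_ge0 ?(ltW eta0)//.
  by have := ler_norm (- f x); rewrite normrN; lra.
rewrite -/k => k1 k2.
have ek : f x / eta * eta = f x by rewrite divfK// gt_eqF.
have {}k1 : k%:R * eta <= f x + N%:R * eta.
  by rewrite -[in leRHS]ek -mulrDl ler_pM2r.
have {}k2 : f x + N%:R * eta < k.+1%:R * eta.
  by rewrite -[in ltLHS]ek -mulrDl ltr_pM2r.
have [j sub] := ball_gap x (t k.+1).
have tE : t k.+1 + eta * j%:R = t (k.+1 + j)%N.
  by rewrite /t -addrA -mulrDr -natrD.
rewrite tE in sub.
have kN : (k <= N + N)%N.
  rewrite -(ler_nat R) natrD -(ler_pM2r eta0).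
  by have := ler_norm (f x); lra.
have jn : (j <= n)%N by rewrite -ltnS.
have : d <= mdist x y; last by rewrite leNgt xyd.
apply: (Hd (k.+1 + j)%N) sub.
- by rewrite mem_iota /= add0n addSn !addnS !ltnS leqW// leq_add.
- rewrite /t natrD mulrDr.
  have : 0 <= eta * j%:R by rewrite mulr_ge0// ltW.
  by move: k2; lra.
- apply: lt_le_trans fxy; rewrite /t natrD -natr1 -(natr1 n.+1) -(natr1 n).
  have : eta * j%:R <= eta * n%:R by rewrite ler_pM2l// ler_nat.
  by move: k1; lra.
Qed.

(** Suppose that large jumps occur at arbitrarily close points. By the bounded
case they occur at points of F i where |f| is as large as desired, so that a
sequence of them can be chosen along which |f| grows by at least eta at each
step. Uniform continuity on F i makes this sequence uniformly discrete, and
[uplaced_discrete] applies even though the levels change with the term. *)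
Lemma piece_jumps_less (i : 'I_n) : jumps_less f (F i) (n.+2%:R * eta).
Proof.
apply: contrapT => Nless.
have eta2 : 0 < n.+2%:R * eta by rewrite mulr_gt0.
have far (N k : nat) : exists p : X * X, [/\ F i p.1, N%:R * eta < `|f p.1|,
    mdist p.1 p.2 < k.+1%:R^-1 & f p.1 + n.+2%:R * eta <= f p.2].
  apply: contrapT => H; apply: Nless.
  have [d d0 Hd] := bounded_jumps_less N.
  exists (Num.min d k.+1%:R^-1); first by rewrite lt_min d0 invr_gt0 ltr0Sn.
  move=> x y Fx; rewrite lt_min => /andP[xyd xyk].
  have [fxN|fxN] := leP `|f x| (N%:R * eta); first exact: Hd.
  by rewrite ltNge; apply/negP => fxy; apply: H; exists (x, y).
pose Q (s : seq (X * X)) (p : X * X) := [/\ F i p.1,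
    forall q, q \in s -> `|f q.1| + eta <= `|f p.1|,
    mdist p.1 p.2 < (size s).+1%:R^-1 & f p.1 + n.+2%:R * eta <= f p.2].
have [s|u Qu] := @history_choice _ Q.
  have [N HN] : exists N : nat, forall q, q \in s -> `|f q.1| + eta <= N%:R * eta.
    elim: s => [|q s [N IH]]; first by exists 0%N.
    pose M := Num.trunc (`|f q.1| / eta).
    have /Num.Theory.truncn_itv/andP[_] : 0 <= `|f q.1| / eta.
      by rewrite divr_ge0// ltW.
    rewrite -/M ltr_pdivrMr// => qM.
    exists (maxn N M.+2) => q'; rewrite inE => /predU1P[->|/IH qN].
      apply: (@le_trans _ _ (M.+2%:R * eta)).
        by rewrite -natr1 mulrDl mul1r lerD2r ltW.
      by rewrite ler_pM2r// ler_nat leq_maxr.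
    by apply: le_trans qN _; rewrite ler_pM2r// ler_nat leq_maxl.
  have [p [Fp Np dp fp]] := far N (size s); exists p; split=> // q /HN qN.
  exact: le_trans qN (ltW Np).
have sep k l : (k < l)%N -> 2 * r <= mdist (u k).1 (u l).1.
  move=> kl; rewrite leNgt; apply/negP.
  have [Fl Hl _ _] := Qu l; have [Fk _ _ _] := Qu k.
  move=> /(fF Fk Fl); rewrite distrC ltNge => /negP; apply.
  have := Hl (u k); rewrite map_f ?mem_iota// => /(_ isT).
  by have := lerB_dist (f (u l).1) (f (u k).1); lra.
have [||d d0 Hd] := @uplaced_discrete R X (fst \o u) (snd \o u) r Xu r0.
- move=> k l /eqP; rewrite neq_ltn => /orP[] /sep//.
  by rewrite metric_sym.
- move=> k; have [_ _ _ fk] := Qu k.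
  have [j sub] := ball_gap (u k).1 (f (u k).1 + eta).
  exists [set z | f z < f (u k).1 + eta + eta * j%:R].
  exists [set z | f (u k).1 + eta + eta * j%:R < f z].
  have jn : eta * j%:R <= eta * n%:R by rewrite ler_pM2l// ler_nat -ltnS.
  have j0 : 0 <= eta * j%:R by rewrite mulr_ge0// ltW.
  have nE : n.+2%:R * eta = eta * n%:R + eta + eta.
    by rewrite -(natr1 n.+1) -(natr1 n) !mulrDl !mul1r mulrC.
  split; split=> //=; first by rewrite -addrA ltrDl ltr_wpDr.
  suff : f (u k).1 + eta + eta * j%:R < f (u k).1 + n.+2%:R * eta.
    by move=> /lt_le_trans; apply.
  by rewrite nE -addrA ltrD2l -addrA [ltLHS]addrC ler_ltD// ltrDl.
have [k /(_ k (leqnn k)) kd] := inv_nat_lt d0.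
have [_ _ + _] := Qu k; rewrite size_mkseq => uk.
by have := Hd k; rewrite leNgt (lt_trans uk kd).
Qed.
End finite_cover.

Lemma uplaced_straight X : uplaced X -> straight X.
Proof.
move=> Xu n F Fc FX f fc; split.
  move=> /unif_continuous_mdistP fu i; apply/unif_continuous_sigLP => e /fu[d d0 Hd].
  by exists d => // x y _ _; exact: Hd.
move=> fF; apply/unif_continuous_mdistP => e e0.
(* One step below the first level, n steps between the levels, one step above. *)
pose eta := e / n.+2%:R.
have eta0 : 0 < eta by rewrite divr_gt0.
have etaE : n.+2%:R * eta = e by rewrite mulrC divfK.
have [||r r0 Hr] := @finite_pos_bound R _ (enum 'I_n) (fun i d =>
    forall x y, F i x -> F i y -> mdist x y < d -> `|f x - f y| < eta).
- by move=> i a b ab H x y Fx Fy xy; apply: H => //; exact: lt_le_trans xy ab.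
- by move=> i _; have /unif_continuous_sigLP/(_ eta eta0) := fF i.
have [||d d0 Hd] := @finite_pos_bound R _ (enum 'I_n) (fun i d =>
    forall x y, F i x -> mdist x y < d -> f y < f x + e).
- by move=> i a b ab H x y Fx xy; apply: H => //; exact: lt_le_trans xy ab.
- move=> i _; rewrite -etaE.
  apply: (@piece_jumps_less X n F f eta (r / 2)) => //; first by rewrite divr_gt0.
  move=> j x y Fx Fy; rewrite mulrC divfK// => xy.
  by apply: (Hr j) => //; rewrite mem_enum.
have jump x y : mdist x y < d -> f y < f x + e.
  have : [set: X] x by []; rewrite -FX => -[i _ Fx].
  by apply: (Hd i) => //; rewrite mem_enum.
exists d => // x y xyd.
have := jump _ _ xyd; have := jump y x; rewrite metric_sym => /(_ xyd).
by rewrite ltr_norml => H1 H2; apply/andP; split; lra.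
Qed.

End uplaced_straight.

(** * Necessity of the conditions *)

Section necessity.
Context {R : realType}.
Implicit Types X Y : metricType R.

Definition locally_unsplit X : Prop := forall r : R, 0 < r ->
  exists2 d : R, 0 < d & forall x y : X, mdist x y < d -> ~ locally_split r x y.

(** The connected set joining two close points is the quasi-component Q of x in
the ball B around x. It is open because near each of its points z nothing can be
split from z inside a smaller ball contained in B. Thus Q is clopen in B, a
clopen part of Q is clopen in B, and Q is connected. *)
Lemma locally_unsplit_ulc X : locally_unsplit X -> ulc X.
Proof.
move=> Xq e e0; pose r := e / 3.
have r0 : 0 < r by rewrite divr_gt0.
have [d d0 Hd] := Xq r r0.
exists (Num.min d r); first by rewrite lt_min d0.
move=> x y; rewrite lt_min => /andP[xyd xyr].
pose Q := [set z | ball x r z /\ ~ exists U V : set X,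
  [/\ open U, open V & U `&` V = set0] /\ [/\ ball x r `<=` U `|` V, U x & V z]].
have oB : open (ball x r) := mdist_ball_open x r.
have oQ : open Q.
  apply/open_mdistP => z [xz Qz].
  have [s s0 zs] := (open_mdistP _).1 oB z xz.
  have [t t0 Ht] := Xq s s0.
  exists (Num.min s t); first by rewrite lt_min s0.
  move=> w /in_ball; rewrite lt_min => /andP[/in_ball ws /Ht wt].
  split; first exact: zs.
  move=> [U [V [UV [sub Ux Vw]]]]; have [Uz|Vz] := sub z xz.
    by apply: wt; exists U, V; do 2!split => //; exact: subset_trans sub.
  by apply: Qz; exists U, V.
have oBQ : open (ball x r `\` Q).
  apply/open_mdistP => z [xz Qz].
  have [U [V [[oU oV UV] [sub Ux Vz]]]] : exists U V : set X,
      [/\ open U, open V & U `&` V = set0] /\ [/\ ball x r `<=` U `|` V, U x & V z].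
    by apply: contrapT => H; apply: Qz; split.
  have [s s0 zs] := (open_mdistP _).1 (openI oB oV) z (conj xz Vz).
  exists s => // w /zs[xw Vw]; split=> // -[_]; apply.
  by exists U, V.
have xx : ball x r x by apply/in_ball; rewrite mdistxx.
have Qx : Q x.
  split=> // -[U [V [[_ _ UV] [_ Ux Vx]]]].
  by have : (U `&` V) x by []; rewrite UV.
exists Q; split=> //; first last.
- apply: (@le_lt_trans _ _ (r + r)%:E).
    apply: diameter_le => a b [/in_ball xa _] [/in_ball xb _].
    have := metric_triangle a x b; rewrite (metric_sym a x); lra.
  by rewrite lte_fin /r; lra.
- split; first exact/in_ball.
  move=> [U [V [UV [sub Ux Vy]]]]; apply: (Hd _ _ xyd).
  by exists U, V.
- move=> E [z Ez] [C oC EC] [C' cC EC'].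
  have oE : open E by rewrite EC; exact: openI.
  have oQE : open (Q `\` E).
    suff -> : Q `\` E = Q `&` ~` C' by apply: openI => //; exact: closed_openC.
    by rewrite EC' setDIr setDv set0U.
  have EQ : E `<=` Q by rewrite EC; exact: subIsetl.
  pose S := (ball x r `\` Q) `|` (Q `\` E).
  have oS : open S by exact: openU.
  have sub : ball x r `<=` E `|` S.
    move=> w xw; have [Ew|Ew] := EM (E w); first by left.
    by right; have [Qw|Qw] := EM (Q w); [right|left].
  have ES : E `&` S = set0.
    apply/seteqP; split=> // w [Ew [[_ NQw]|[_ NEw]]]; last exact: NEw.
    exact/NQw/EQ.
  apply/seteqP; split=> // w Qw; apply: contrapT => Ew.
  have [Ex|Ex] := EM (E x).
    by have [_] := Qw; apply; exists E, S; do 2!split => //; right.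
  have [_] := EQ _ Ez; apply; exists S, E; rewrite setIC setUC.
  by do 2!split => //; right.
Qed.

Lemma not_totally_bounded_separated X : ~ totally_bounded X ->
  exists2 e : R, 0 < e &
    exists x : nat -> X, forall k l, k <> l -> e <= mdist (x k) (x l).
Proof.
move=> Xtb; apply: contrapT => H; apply: Xtb => e e0.
apply: contrapT => Ncov; apply: H; exists e => //.
have [s|x xsep] := @history_choice X (fun s x => forall z, z \in s -> e <= mdist z x).
  apply: contrapT => Hs; apply: Ncov; exists [set` s]; first exact: finite_seq.
  apply/seteqP; split=> // x _; apply: contrapT => Nx; apply: Hs; exists x => z zs.
  by rewrite leNgt; apply/negP => zx; apply: Nx; exists z => //; exact/in_ball.
have sep k l : (k < l)%N -> e <= mdist (x k) (x l).
  by move=> kl; apply: xsep; rewrite map_f// mem_iota.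
exists x => k l /eqP; rewrite neq_ltn => /orP[] /sep//.
by rewrite metric_sym.
Qed.

Lemma open_slice2 X Y (x : X) (U : set (l1prod X Y)) :
  open U -> open [set y | U (x, y)].
Proof.
move=> oU; apply/open_mdistP => y /((open_mdistP U).1 oU)[e e0 He].
exists e => // z /in_ball yz; apply/He/in_ball.
by rewrite l1distE /= mdistxx add0r.
Qed.

Lemma open_slice1 X Y (y : Y) (U : set (l1prod X Y)) :
  open U -> open [set x | U (x, y)].
Proof.
move=> oU; apply/open_mdistP => x /((open_mdistP U).1 oU)[e e0 He].
exists e => // z /in_ball xz; apply/He/in_ball.
by rewrite l1distE /= mdistxx addr0.
Qed.

Lemma open_cylinder2 X Y (U : set Y) :
  open U -> open [set p : l1prod X Y | U p.2].
Proof.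
move=> oU; apply/open_mdistP => p /((open_mdistP U).1 oU)[e e0 He].
exists e => // q /in_ball; rewrite l1distE => pq; apply/He/in_ball.
by have := mdist_ge0 p.1 q.1; lra.
Qed.

(** Bad pairs of Y, the k-th one being closer than 1 / (k + 1) and split inside
a ball of fixed radius, are placed in the fibres over a uniformly discrete
sequence of X. *)
Lemma uplaced_prod_ulc X Y :
  uplaced (l1prod X Y) -> ~ totally_bounded X -> ulc Y.
Proof.
move=> XYu /not_totally_bounded_separated[e e0 [x xsep]].
apply: locally_unsplit_ulc => r r0; apply: contrapT => H.
have {}H k : exists p : Y * Y,
    mdist p.1 p.2 < k.+1%:R^-1 /\ locally_split r p.1 p.2.
  apply: contrapT => Hk; apply: H; exists k.+1%:R^-1.
    by rewrite invr_gt0 ltr0Sn.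
  by move=> y z yz yzr; apply: Hk; exists (y, z).
have [p Hp] := choice H.
(* The points of the sequence are e apart, so radius e / 2 keeps balls disjoint. *)
pose s := Num.min r (e / 2).
have s0 : 0 < s by rewrite lt_min r0 divr_gt0.
have se : 2 * s <= e by have : s <= e / 2 by [rewrite ge_min lexx orbT]; lra.
have [||d d0 Hd] := @uplaced_discrete R (l1prod X Y)
  (fun k => (x k, (p k).1)) (fun k => (x k, (p k).2)) s XYu s0.
- move=> k l /xsep; rewrite l1distE /=.
  by have := mdist_ge0 (p k).1 (p l).1; lra.
- move=> k; have [_ [U [V [[oU oV UV] [sub Up Vp]]]]] := Hp k.
  exists [set q : l1prod X Y | U q.2], [set q : l1prod X Y | V q.2].
  split; split=> //=; [exact: open_cylinder2|exact: open_cylinder2| |].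
    by apply/seteqP; split=> // q [/= Uq Vq]; have : (U `&` V) q.2 by []; rewrite UV.
  move=> q /in_ball; rewrite l1distE /= lt_min => /andP[qr _].
  by apply: sub; apply/in_ball; have := mdist_ge0 (x k) q.1; lra.
have [k /(_ k (leqnn k)) kd] := inv_nat_lt d0.
have [pk _] := Hp k; have := Hd k.
by rewrite l1distE /= mdistxx add0r leNgt (lt_trans pk kd).
Qed.

End necessity.

(** * Products with uniformly locally connected factors *)

Section products.
Context {R : realType}.
Implicit Types X Y : metricType R.

Definition swap_prod X Y (p : l1prod X Y) : l1prod Y X := (p.2, p.1).

Lemma mdist_swap X Y (p q : l1prod X Y) :
  mdist (swap_prod p) (swap_prod q) = mdist p q.
Proof. by rewrite !l1distE addrC. Qed.

Lemma open_swap X Y (U : set (l1prod Y X)) :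
  open U -> open ((@swap_prod X Y) @^-1` U).
Proof.
move=> oU; apply/open_mdistP => p /((open_mdistP U).1 oU)[e e0 He].
by exists e => // q /in_ball pq; apply/He/in_ball; rewrite mdist_swap.
Qed.

Lemma uplaced_swap X Y : uplaced (l1prod X Y) -> uplaced (l1prod Y X).
Proof.
move=> XYu U V r oU oV UV r0.
have [|d d0 Hd] := XYu _ _ r (open_swap oU) (open_swap oV) _ r0.
  by rewrite -preimage_setI UV preimage_set0.
exists d => // -[y x] [y' x'] Up Vq sub; rewrite -mdist_swap.
apply: Hd => // s /in_ball; rewrite -mdist_swap => ps.
by apply: (sub (swap_prod s)); exact/in_ball.
Qed.

Lemma uplaced_prod_snd X Y (x0 : X) : uplaced (l1prod X Y) -> uplaced Y.
Proof.
move=> XYu U V r oU oV UV r0.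
have [|d d0 Hd] := XYu _ _ r (open_cylinder2 oU) (open_cylinder2 oV) _ r0.
  by apply/seteqP; split=> // q [/= Uq Vq]; have : (U `&` V) q.2 by []; rewrite UV.
exists d => // y z Uy Vz sub.
have := Hd (x0, y) (x0, z) Uy Vz; rewrite l1distE /= mdistxx add0r; apply.
move=> q /in_ball; rewrite l1distE /= => qr; apply: sub; apply/in_ball.
by have := mdist_ge0 x0 q.1; lra.
Qed.

Lemma connected_hslice X Y (C : set X) (y : Y) (x : X) (U V : set (l1prod X Y)) :
  open U -> open V -> U `&` V = set0 -> connected C -> C x -> U (x, y) ->
  (forall c, C c -> (U `|` V) (c, y)) -> forall c, C c -> U (c, y).
Proof.
move=> oU oV UV Cc Cx Uxy sub.
apply: (@connected_open_split R X C [set c | U (c, y)] [set c | V (c, y)] x) => //.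
- exact: open_slice1.
- exact: open_slice1.
- by apply/seteqP; split=> // c [/= Uc Vc]; have : (U `&` V) (c, y) by []; rewrite UV.
Qed.

Lemma connected_vslice X Y (C : set Y) (x : X) (y : Y) (U V : set (l1prod X Y)) :
  open U -> open V -> U `&` V = set0 -> connected C -> C y -> U (x, y) ->
  (forall c, C c -> (U `|` V) (x, c)) -> forall c, C c -> U (x, c).
Proof.
move=> oU oV UV Cc Cx Uxy sub.
apply: (@connected_open_split R Y C [set c | U (x, c)] [set c | V (x, c)] y) => //.
- exact: open_slice2.
- exact: open_slice2.
- by apply/seteqP; split=> // c [/= Uc Vc]; have : (U `&` V) (x, c) by []; rewrite UV.
Qed.

(** From (x, y) in U one reaches (x', y') through C x {y} and {x'} x D, both of
which lie in the ball on which U and V are complementary. *)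
Lemma ulc_prod_uplaced X Y : ulc X -> ulc Y -> uplaced (l1prod X Y).
Proof.
move=> Xl Yl U V r oU oV UV r0.
have r2 : 0 < r / 2 by rewrite divr_gt0.
have [d d0 Hd] := Xl _ r2; have [e e0 He] := Yl _ r2.
exists (Num.min d e); first by rewrite lt_min d0.
move=> [x y] [x' y'] Uxy Vxy sub; rewrite l1distE /= leNgt; apply/negP => dist.
have [C [Cc Cx Cx' Cr]] : exists C : set X,
    [/\ connected C, C x, C x' & (diameter C < (r / 2)%:E)%E].
  apply: Hd; move: dist; rewrite lt_min => /andP[+ _].
  by have := mdist_ge0 y y'; lra.
have [D [Dc Dy Dy' Dr]] : exists D : set Y,
    [/\ connected D, D y, D y' & (diameter D < (r / 2)%:E)%E].
  apply: He; move: dist; rewrite lt_min => /andP[_ +].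
  by have := mdist_ge0 x x'; lra.
have UCD c z : C c -> D z -> (U `|` V) (c, z).
  move=> Cz Dz; apply: sub; apply/in_ball; rewrite l1distE /=.
  by have := diameter_ltP Cr Cx Cz; have := diameter_ltP Dr Dy Dz; lra.
have Ux'y : U (x', y).
  exact: (connected_hslice oU oV UV Cc Cx Uxy (fun c Cc' => UCD _ _ Cc' Dy)).
have Ux'y' : U (x', y').
  exact: (connected_vslice oU oV UV Dc Dy Ux'y (fun z Dz => UCD _ _ Cx' Dz)).
by have : (U `&` V) (x', y') by []; rewrite UV.
Qed.

(** Two close points (x, y) in U and (x', y') in V have first coordinates near
the same point a of a finite net. Small connected sets of X carry them inside U
and V to (a, y) and (a, y'), two points of the fibre over a. *)
Lemma totally_bounded_ulc_prod_uplaced X Y :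
  totally_bounded X -> ulc X -> uplaced Y -> uplaced (l1prod X Y).
Proof.
move=> Xtb Xl Yu U V r oU oV UV r0.
have r2 : 0 < r / 2 by rewrite divr_gt0.
have [d0 d00 Hd0] := Xl _ r2.
pose d := Num.min d0 (r / 2).
have dd0 : d <= d0 by rewrite ge_min lexx.
have dr : d <= r / 2 by rewrite ge_min lexx orbT.
have d_gt0 : 0 < d by rewrite lt_min d00.
have d2 : 0 < d / 2 by rewrite divr_gt0.
have [_ /finite_seqP[s ->] cov] := Xtb _ d2.
have [||e e0 He] := @finite_pos_bound R X s (fun a e => forall y z,
    U (a, y) -> V (a, z) ->
    ball y (r / 2) `<=` [set y | U (a, y)] `|` [set y | V (a, y)] -> e <= mdist y z).
- by move=> a b c bc H y z Uy Vz sub; exact: le_trans bc (H y z Uy Vz sub).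
- move=> a _; apply: (Yu _ _ _ (open_slice2 a oU) (open_slice2 a oV) _ r2).
  by apply/seteqP; split=> // c [/= Uc Vc]; have : (U `&` V) (a, c) by []; rewrite UV.
exists (Num.min e (d / 2)); first by rewrite lt_min e0.
move=> [x y] [x' y'] Uxy Vxy sub; rewrite l1distE /= leNgt lt_min.
apply/negP => /andP[diste distd].
have [a sa /in_ball ax] : (\bigcup_(a in [set` s]) ball a (d / 2)) x by rewrite -cov.
have xx0 := mdist_ge0 x x'; have yy0 := mdist_ge0 y y'.
have ax' : mdist a x' < d by have := metric_triangle a x x'; lra.
have [C [Cc Ca Cx Cr]] := Hd0 a x ltac:(lra).
have [D [Dc Da Dx Dr]] := Hd0 a x' ltac:(lra).
have Uay : U (a, y).
  apply: (connected_hslice oU oV UV Cc Cx Uxy _ Ca) => c Cc'.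
  apply: sub; apply/in_ball; rewrite l1distE /= mdistxx addr0.
  by have := diameter_ltP Cr Cx Cc'; lra.
have Vay' : V (a, y').
  have VU : V `&` U = set0 by rewrite setIC.
  apply: (connected_hslice oV oU VU Dc Dx Vxy _ Da) => c Dc'.
  rewrite setUC; apply: sub; apply/in_ball; rewrite l1distE /=.
  have := metric_triangle x x' c; have := diameter_ltP Dr Dx Dc'; lra.
suff : e <= mdist y y' by lra.
apply: (He a sa _ _ Uay Vay') => z /in_ball yz; apply: sub; apply/in_ball.
by rewrite l1distE /= (metric_sym x a); lra.
Qed.

End products.

(** * Products of precompact spaces *)

Section ideal_points.
Context {R : realType}.
Implicit Types X Y : metricType R.

(** The traces on X of the neighbourhood filters of the points of its
completion: the Cauchy filters that are round, that is, that contain with N some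
uniform interior of N. *)
Definition ideal_point X (Z : set_system X) : Prop :=
  [/\ ProperFilter Z,
      forall e : R, 0 < e -> exists x, Z (ball x e) &
      forall N, Z N -> exists2 e : R, 0 < e & Z [set x | ball x e `<=` N]].

Lemma ideal_nbhs X (x : X) : ideal_point (nbhs x).
Proof.
split; first exact: nbhs_pfilter.
  by move=> e e0; exists x; apply/nbhs_mdist_ball; exists e.
move=> N /nbhs_mdist_ball[e e0 He]; exists (e / 2); first by rewrite divr_gt0.
apply/nbhs_mdist_ball; exists (e / 2); first by rewrite divr_gt0.
move=> y /in_ball xy z /in_ball yz; apply/He/in_ball.
by have := metric_triangle x y z; lra.
Qed.

(** Roundness turns members of radius 1 / (k + 1), which exist by the Cauchy
property, into a base. *)
Lemma ideal_countable_base X (Z : set_system X) : ideal_point Z ->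
  exists2 B : nat -> set X, forall k, Z (B k) &
    forall N, Z N -> exists K, forall k, (K <= k)%N -> B k `<=` N.
Proof.
move=> [ZF Zc Zr].
have /choice[c Hc] (k : nat) : exists c, Z (ball c (k.+1%:R^-1 : R)).
  by apply: Zc; rewrite invr_gt0 ltr0Sn.
exists (fun k => ball (c k) k.+1%:R^-1) => // N /Zr[e e0 Ze].
have e2 : 0 < e / 2 by rewrite divr_gt0.
have [K HK] := inv_nat_lt e2.
exists K => k /HK ke z /in_ball cz.
have [x [sub /in_ball cx]] := filter_ex (filterI Ze (Hc k)).
apply: sub; apply/in_ball.
have {}cx := lt_trans cx ke; have {}cz := lt_trans cz ke.
by have := metric_triangle x (c k) z; rewrite (metric_sym x (c k)); lra.
Qed.

(** Near the ideal point there are points x whose e-ball lies in the union of U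
and V. The smaller balls around such an x that belong to the filter lie on the
same side as x. *)
Lemma ideal_tight X (Z : set_system X) (U V : set X) :
  uplaced X -> ideal_point Z -> open U -> open V -> U `&` V = set0 ->
  Z (U `|` V) -> Z U \/ Z V.
Proof.
move=> Xu [ZF Zc Zr] oU oV UV /Zr[e e0 Ze].
have [d d0 Hd] := Xu _ _ e oU oV UV e0.
have [d' d'0 Hd'] := Xu _ _ e oV oU (etrans (setIC _ _) UV) e0.
pose s := Num.min e (Num.min d d').
have s0 : 0 < s by rewrite !lt_min e0 d0.
have [|c Zs] := Zc (s / 2); first by rewrite divr_gt0.
have [x [sub /in_ball cx]] := filter_ex (filterI Ze Zs).
have {}Zs : Z (ball x s).
  apply: filterS Zs => y /in_ball cy; apply/in_ball.
  by have := metric_triangle x c y; rewrite (metric_sym x c); lra.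
have near_x y : ball x s y -> [/\ ball x e y, mdist x y < d & mdist x y < d'].
  by move=> /in_ball; rewrite !lt_min => /and3P[? ? ?]; split=> //; apply/in_ball.
have [Ux|Vx] : (U `|` V) x by apply: sub; apply/in_ball; rewrite mdistxx.
  left; apply: filterS Zs => y /near_x[/sub[//|Vy]] + _.
  by rewrite ltNge Hd.
right; apply: filterS Zs => y /near_x[/sub[Uy|//]] _.
by rewrite ltNge Hd' 1?setUC.
Qed.

(** If phi is unbounded near Z, there are points u k converging to Z along which
phi increases strictly. The set S of the values at even positions then defines
two clopen parts of M, phi in S and phi not in S, both of which meet every member
of Z, against tightness. *)
Lemma locally_constant_bounded X (Z : set_system X) (M : set X) (phi : X -> nat) :
  uplaced X -> ideal_point Z -> open M -> Z M ->
  (forall x, M x -> \forall y \near x, phi y = phi x) ->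
  exists n, Z [set x | (phi x <= n)%N].
Proof.
move=> Xu Zi oM ZM phic; apply: contrapT => unb.
have [ZF _ _] := Zi; have [B ZB HB] := ideal_countable_base Zi.
pose Q (s : seq X) x := B (size s) x /\ forall z, z \in s -> (phi z < phi x)%N.
have [s|u Qu] := @history_choice X Q.
  have [n Hn] : exists n, forall z, z \in s -> (phi z <= n)%N.
    exists (\max_(z <- s) phi z) => z zs.
    exact: (@leq_bigmax_seq _ s xpredT phi z zs isT).
  apply: contrapT => H; apply: unb; exists n; apply: filterS (ZB (size s)) => x Bx.
  rewrite /= leqNgt; apply/negP => nx; apply: H; exists x; split=> // z /Hn zn.
  exact: leq_ltn_trans zn nx.
have uB k : B k (u k) by have [] := Qu k; rewrite size_mkseq.
have umono k l : (k < l)%N -> (phi (u k) < phi (u l))%N.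
  by move=> kl; have [_] := Qu l; apply; rewrite map_f// mem_iota.
have uinj k l : phi (u k) = phi (u l) -> k = l.
  move=> E; case: (ltngtP k l) => // /umono; by rewrite E ltnn.
have oPhi (S : nat -> Prop) : open (M `&` [set x | S (phi x)]).
  rewrite openE => x [Mx Sx].
  have : nbhs x M by exact: open_nbhs_nbhs.
  by apply: filterS2 (phic x Mx) => y /= -> My.
pose S n := exists j, n = phi (u j.*2).
have [||ZE|ZO] := @ideal_tight X Z _ _ Xu Zi (oPhi S) (oPhi (fun n => ~ S n)).
- by apply/seteqP; split=> // x [[_ Sx] [_ NSx]].
- apply: filterS ZM => x Mx; have [Sx|Sx] := EM (S (phi x)); by [left|right].
- have [K HK] := HB _ ZE.
  have [|_ [j /uinj E]] := HK K.*2.+1 _ _ (uB _).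
    by rewrite -addnn -addnS leq_addr.
  by have := congr1 odd E; rewrite /= !odd_double.
- have [K HK] := HB _ ZO.
  have [|_] := HK K.*2 _ _ (uB _); first by rewrite -addnn leq_addr.
  by apply; exists K.
Qed.

(** For each t in Q the set of the x in P with D x t is relatively clopen. If
these sets stay away, as t tends to W, from each point of P, then they stay away
from the ideal point Z too: for a sequence p k of counterexamples tending to
(Z, W), the set of the indices k with D x (p k).2 is finite and locally constant
in x, so an upper bound of it is a locally constant function of x, and
[locally_constant_bounded] bounds the indices near Z. *)
Lemma locally_finite_avoid X Y (Z : set_system X) (W : set_system Y)
    (P : set X) (Q : set Y) (D : X -> Y -> Prop) :
  uplaced X -> ideal_point Z -> ideal_point W -> open P -> Z P -> W Q ->
  (forall t, Q t -> open (P `&` [set x | D x t])) ->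
  (forall t, Q t -> open (P `&` [set x | ~ D x t])) ->
  (forall x, P x -> exists2 O, nbhs x O & W [set t | forall x', O x' -> ~ D x' t]) ->
  exists2 N, Z N & W [set t | forall x, N x -> ~ D x t].
Proof.
move=> Xu Zi Wi oP ZP WQ oD oND Dfin.
have [ZF _ _] := Zi; have [WF _ _] := Wi.
apply: contrapT => H.
have [B ZB HB] := ideal_countable_base Zi.
have [C WC HC] := ideal_countable_base Wi.
have {}H k : exists p : X * Y, [/\ B k p.1, P p.1, C k p.2, Q p.2 & D p.1 p.2].
  apply: contrapT => Hk; apply: H; exists (B k `&` P); first exact: filterI.
  apply: filterS (filterI (WC k) WQ) => t [Ct Qt] x [Bx Px] Dxt.
  by apply: Hk; exists (x, t).
have [p Hp] := choice H.
(* Any choice of an upper bound will do, as long as it depends only on the set of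
   indices; the default 0 is for infinite sets, which do not occur over P. *)
pose psi (A : nat -> Prop) := xget 0%N [set n | forall k, A k -> (k < n)%N].
pose mem x k := D x (p k).2.
have fin x : P x -> exists2 O, nbhs x O &
    exists K, forall k, (K <= k)%N -> forall x', O x' -> ~ mem x' k.
  move=> /Dfin[O Ox WO]; exists O => //; have [K HK] := HC _ WO.
  by exists K => k /HK; apply; have [] := Hp k.
have psiP x k : P x -> mem x k -> (k < psi (mem x))%N.
  move=> Px; have [O /nbhs_singleton Ox [K HK]] := fin x Px.
  suff : [set n | forall k, mem x k -> (k < n)%N] (psi (mem x)) by apply.
  apply: (@xgetPex _ 0%N [set n | forall k, mem x k -> (k < n)%N]).
  exists K => l xl; rewrite ltnNge; apply/negP => /HK/(_ x Ox); exact.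
have memc x : P x -> \forall y \near x, mem y = mem x.
  move=> Px; have [O nO [K HK]] := fin x Px.
  have memK (k : 'I_K) : \forall y \near x, mem y k = mem x k.
    have [_ _ _ Qk _] := Hp k.
    have [xk|xk] := EM (mem x k).
      have : nbhs x (P `&` [set x | mem x k]).
        by apply: open_nbhs_nbhs; split=> //; exact: oD.
      by apply: filterS => y [_ yk]; apply/propext.
    have : nbhs x (P `&` [set x | ~ mem x k]).
      by apply: open_nbhs_nbhs; split=> //; exact: oND.
    by apply: filterS => y [_ yk]; apply/propext.
  have {}memK : \forall y \near x, forall k : 'I_K, mem y k = mem x k.
    exact: filter_forall.
  have Ox := nbhs_singleton nO.
  apply: filterS2 nO memK => y Oy yK; apply/funext => k.
  have [kK|Kk] := ltnP k K; first exact: (yK (Ordinal kK)).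
  by apply/propext; split=> /(HK _ Kk _ _).
have [|n Zn] := @locally_constant_bounded X Z P (psi \o mem) Xu Zi oP ZP.
  by move=> x /memc; apply: filterS => y /= ->.
have [K HK] := HB _ Zn.
pose k := maxn K n.
have [Bk Pk _ _ Dk] := Hp k.
have := HK k (leq_maxl _ _) _ Bk; rewrite /= leqNgt.
by rewrite (leq_ltn_trans (leq_maxr K n))// psiP.
Qed.

(** If (Z, y) lies on the side of U, then so does a whole neighbourhood of it in
the product: tightness passes from X to the product with a genuine point y of
Y. *)
Lemma ideal_avoid_fiber X Y (Z : set_system X) (P : set X) (Q : set Y)
    (U V : set (l1prod X Y)) (y : Y) :
  uplaced X -> ideal_point Z -> open P -> open Q -> Z P -> Q y ->
  open U -> open V -> U `&` V = set0 ->
  (forall x t, P x -> Q t -> (U `|` V) (x, t)) ->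
  Z [set x | U (x, y)] ->
  exists2 N, Z N & nbhs y [set t | forall x, N x -> ~ V (x, t)].
Proof.
move=> Xu Zi oP oQ ZP Qy oU oV UV PQ ZU.
have [ZF _ _] := Zi.
have UVN p : U p -> ~ V p by move=> Up Vp; have : (U `&` V) p by []; rewrite UV.
pose M := P `&` [set x | U (x, y)].
have oM : open M by apply: openI => //; exact: open_slice1.
apply: (@locally_finite_avoid X Y Z (nbhs y) M Q (fun x t => V (x, t))) => //.
- exact: ideal_nbhs.
- exact: filterI.
- exact: open_nbhs_nbhs.
- by move=> t _; apply: openI => //; exact: open_slice1.
- move=> t Qt; suff -> : M `&` [set x | ~ V (x, t)] = M `&` [set x | U (x, t)].
    by apply: openI => //; exact: open_slice1.
  apply/seteqP; split=> x [Mx] /= UVx; split=> //; last exact: UVN.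
  by have [] := PQ x t Mx.1 Qt.
- move=> x [Px /= Ux]; have [e e0 He] := (open_mdistP U).1 oU _ Ux.
  have e2 : 0 < e / 2 by rewrite divr_gt0.
  exists (ball x (e / 2)); first by apply/nbhs_mdist_ball; exists (e / 2).
  apply/nbhs_mdist_ball; exists (e / 2) => // t /in_ball yt x' /in_ball xx'.
  by apply/UVN/He/in_ball; rewrite l1distE /=; lra.
Qed.

(** The same passage in the other variable: the fibres over the points y of A
are on the side of U near Z, hence so is a neighbourhood of (Z, W). *)
Lemma ideal_avoid_product X Y (Z : set_system X) (W : set_system Y)
    (P : set X) (A : set Y) (U V : set (l1prod X Y)) :
  uplaced Y -> ideal_point Z -> ideal_point W -> Z P -> open A -> W A ->
  open U -> open V -> U `&` V = set0 ->
  (forall x y, P x -> A y -> (U `|` V) (x, y)) ->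
  (forall y, A y -> exists2 N, Z N & nbhs y [set t | forall x, N x -> ~ V (x, t)]) ->
  exists2 N, Z N & exists2 N', W N' & forall x y, N x -> N' y -> ~ V (x, y).
Proof.
move=> Yu Zi Wi ZP oA WA oU oV UV PA AN; have [ZF _ _] := Zi.
have UVN p : U p -> ~ V p by move=> Up Vp; have : (U `&` V) p by []; rewrite UV.
have [|||N' WN' ZN] := @locally_finite_avoid Y X W Z A P (fun y x => V (x, y))
  Yu Wi Zi oA WA ZP.
- by move=> x _; apply: openI => //; exact: open_slice2.
- move=> x Px; suff -> : A `&` [set y | ~ V (x, y)] = A `&` [set y | U (x, y)].
    by apply: openI => //; exact: open_slice2.
  apply/seteqP; split=> y [Ay] /= UVy; split=> //; last exact: UVN.
  by have [] := PA x y Px Ay.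
- move=> y /AN[N ZN nN]; exists [set t | forall x, N x -> ~ V (x, t)] => //.
  by apply: filterS ZN => x Nx t; apply.
exists [set x | forall y, N' y -> ~ V (x, y)] => //; exists N' => // x y; exact.
Qed.

(** Each point y of Q gets the side on which (Z, y) lies. By [ideal_avoid_fiber]
this side is locally constant in y, so by tightness of Y it is constant near
W. *)
Lemma ideal_tight_prod X Y (Z : set_system X) (W : set_system Y)
    (P : set X) (Q : set Y) (U V : set (l1prod X Y)) :
  uplaced X -> uplaced Y -> ideal_point Z -> ideal_point W ->
  open P -> open Q -> Z P -> W Q ->
  open U -> open V -> U `&` V = set0 ->
  (forall x y, P x -> Q y -> (U `|` V) (x, y)) ->
  exists2 N, Z N & exists2 N', W N' &
    (forall x y, N x -> N' y -> ~ V (x, y)) \/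
    (forall x y, N x -> N' y -> ~ U (x, y)).
Proof.
move=> Xu Yu Zi Wi oP oQ ZP WQ oU oV UV PQ.
have [ZF _ _] := Zi; have [WF _ _] := Wi.
have VU : V `&` U = set0 by rewrite setIC.
have QP x y : P x -> Q y -> (V `|` U) (x, y).
  by move=> Px Qy; rewrite setUC; exact: PQ.
pose A (D : set (l1prod X Y)) := Q `&`
  [set y | exists2 N, Z N & nbhs y [set t | forall x, N x -> ~ D (x, t)]].
have oA D : open (A D).
  rewrite openE => y [Qy [N ZN nN]].
  have : nbhs y Q by exact: open_nbhs_nbhs.
  have : nbhs y [set t | nbhs t [set t' | forall x, N x -> ~ D (x, t')]].
    exact: nbhs_interior.
  by apply: filterS2 => t nt Qt; split=> //; exists N.
have Adis : A V `&` A U = set0.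
  apply/seteqP; split=> // y [[Qy [N ZN /nbhs_singleton nN]]].
  move=> [_ [N' ZN' /nbhs_singleton nN']].
  have [x [Px [Nx N'x]]] := filter_ex (filterI ZP (filterI ZN ZN')).
  by have [/nN'|/nN] := PQ x y Px Qy; apply.
have Acov : W (A V `|` A U).
  apply: filterS WQ => y Qy.
  have [||ZU|ZV] := @ideal_tight X Z [set x | U (x, y)] [set x | V (x, y)] Xu Zi
    (open_slice1 y oU) (open_slice1 y oV).
  - by apply/seteqP; split=> // x [/= Ux Vx]; have : (U `&` V) (x, y) by []; rewrite UV.
  - by apply: filterS ZP => x Px; exact: PQ.
  - left; split=> //.
    exact: (ideal_avoid_fiber Xu Zi oP oQ ZP Qy oU oV UV PQ ZU).
  - right; split=> //.
    exact: (ideal_avoid_fiber Xu Zi oP oQ ZP Qy oV oU VU QP ZV).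
have [WA|WA] := ideal_tight Yu Wi (oA V) (oA U) Adis Acov.
  have [||N ZN [N' WN' H]] :=
      ideal_avoid_product Yu Zi Wi ZP (oA V) WA oU oV UV.
  - by move=> x y Px [Qy _]; exact: PQ.
  - by move=> y [].
  by exists N => //; exists N' => //; left.
have [||N ZN [N' WN' H]] := ideal_avoid_product Yu Zi Wi ZP (oA U) WA oV oU VU.
- by move=> x y Px [Qy _]; exact: QP.
- by move=> y [].
by exists N => //; exists N' => //; right.
Qed.

Lemma ultra_finite_cover T (G : set_system T) (I : eqType) (s : seq I)
    (P : I -> set T) : UltraFilter G ->
  G [set k | exists2 i, i \in s & P i k] -> exists2 i, i \in s & G (P i).
Proof.
move=> GU; elim: s => [|i s IH] Gs.
  by have [k []] := filter_ex Gs.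
have [Gi|Gi] := in_ultra_setVsetC (P i) GU; first by exists i => //; exact: mem_head.
have [|j js Gj] := IH; last by exists j => //; rewrite inE js orbT.
apply: filterS (filterI Gs Gi) => k [[j + Pj] NPi].
by rewrite inE => /predU1P[ji|js]; [case: NPi; rewrite -ji|exists j].
Qed.

(** The round filter below the image of G under a. *)
Definition limit_along T X (G : set_system T) (a : T -> X) : set_system X :=
  [set N | exists2 e : R, 0 < e & G [set k | ball (a k) e `<=` N]].

(** Precompactness makes the image of an ultrafilter a Cauchy filter: one of
finitely many small balls covering X is in it. *)
Lemma ultra_limit_ideal T X (G : set_system T) (a : T -> X) :
  UltraFilter G -> totally_bounded X -> ideal_point (limit_along G a).
Proof.
move=> GU Xtb; split.
- split; last split.
  + move=> [e e0 /filter_ex[k]]; move=> /(_ (a k)); apply.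
    by apply/in_ball; rewrite mdistxx.
  + by exists 1 => //; apply: filterS filterT.
  + move=> A B [e e0 Ge] [d d0 Gd]; exists (Num.min e d); first by rewrite lt_min e0.
    apply: filterS2 Ge Gd => k eA dB x /in_ball; rewrite lt_min => /andP[xe xd].
    by split; [apply/eA/in_ball|apply/dB/in_ball].
  + move=> A B AB [e e0 Ge]; exists e => //; apply: filterS Ge => k eA.
    exact: subset_trans AB.
- move=> e e0; have e2 : 0 < e / 2 by rewrite divr_gt0.
  have [_ /finite_seqP[s ->] cov] := Xtb _ e2.
  have [|x xs Gx] := @ultra_finite_cover T G X s (fun x k => ball x (e / 2) (a k)) GU.
    apply: filterS filterT => k _.
    by have : [set: X] (a k) by []; rewrite cov => -[x xs xk]; exists x.
  exists x, (e / 2) => //; apply: filterS Gx => k /in_ball xk y /in_ball ky.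
  by apply/in_ball; have := metric_triangle x (a k) y; lra.
- move=> N [e e0 Ge]; have e2 : 0 < e / 2 by rewrite divr_gt0.
  exists (e / 2) => //; exists (e / 2) => //.
  apply: filterS Ge => k kN y /in_ball ky z /in_ball yz.
  by apply/kN/in_ball; have := metric_triangle (a k) y z; lra.
Qed.

(** A sequence of pairs of points of U and of V, closer and closer to each other,
tends along an ultrafilter to a pair of ideal points, at which it contradicts
tightness of the product. *)
Lemma totally_bounded_prod_uplaced X Y :
  totally_bounded X -> totally_bounded Y -> uplaced X -> uplaced Y ->
  uplaced (l1prod X Y).
Proof.
move=> Xtb Ytb Xu Yu U V r oU oV UV r0; apply: contrapT => H.
have {}H k : exists p : l1prod X Y * l1prod X Y, [/\ U p.1, V p.2,
    ball p.1 r `<=` U `|` V & mdist p.1 p.2 < k.+1%:R^-1].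
  apply: contrapT => Hk; apply: H; exists k.+1%:R^-1.
    by rewrite invr_gt0 ltr0Sn.
  move=> x y Ux Vy sub; rewrite leNgt; apply/negP => xy.
  by apply: Hk; exists (x, y).
have [p Hp] := choice H.
have [G [GU Goo]] := ultraFilterLemma (eventually_filter).
have Gnear (e : R) : 0 < e -> G [set k | mdist (p k).1 (p k).2 < e].
  move=> /inv_nat_lt[K HK]; apply: Goo; exists K => // k /= /HK.
  by have [_ _ _] := Hp k; exact: lt_trans.
pose a k := (p k).1.1; pose b k := (p k).1.2.
have Zi := ultra_limit_ideal a GU Xtb; have Wi := ultra_limit_ideal b GU Ytb.
have [_ Zc _] := Zi; have [_ Wc _] := Wi.
have r4 : 0 < r / 4 by rewrite divr_gt0.
have [x0 Zx0] := Zc _ r4; have [y0 Wy0] := Wc _ r4.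
have aN N : limit_along G a N -> G [set k | N (p k).1.1 /\ N (p k).2.1].
  move=> [e e0 Ge]; apply: filterS2 Ge (Gnear e e0) => k sub /=.
  rewrite l1distE => pk; split; apply: sub; apply/in_ball; rewrite ?mdistxx//.
  by have := mdist_ge0 (p k).1.2 (p k).2.2; rewrite /a; lra.
have bN N : limit_along G b N -> G [set k | N (p k).1.2 /\ N (p k).2.2].
  move=> [e e0 Ge]; apply: filterS2 Ge (Gnear e e0) => k sub /=.
  rewrite l1distE => pk; split; apply: sub; apply/in_ball; rewrite ?mdistxx//.
  by have := mdist_ge0 (p k).1.1 (p k).2.1; rewrite /b; lra.
have [k0 [[/in_ball ak0 _] [/in_ball bk0 _]]] :=
  filter_ex (filterI (aN _ Zx0) (bN _ Wy0)).
have [|N ZN [N' WN' HN]] := ideal_tight_prod Xu Yu Zi Wi (mdist_ball_open x0 _)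
  (mdist_ball_open y0 _) Zx0 Wy0 oU oV UV.
  move=> x y /in_ball xx0 /in_ball yy0; have [_ _ sub _] := Hp k0.
  apply: sub; apply/in_ball; rewrite l1distE /=.
  have := metric_triangle (p k0).1.1 x0 x; rewrite (metric_sym _ x0).
  by have := metric_triangle (p k0).1.2 y0 y; rewrite (metric_sym _ y0); lra.
have [k [[Npk Nqk] [N'pk N'qk]]] := filter_ex (filterI (aN _ ZN) (bN _ WN')).
have [Up Vq _ _] := Hp k.
have [/(_ _ _ Nqk N'qk)|/(_ _ _ Npk N'pk)] := HN; apply.
  by case: (p k).2 Vq.
by case: (p k).1 Up.
Qed.

End ideal_points.

(** * The characterization *)

Theorem theoremA (R : realType) (X Y : metricType R)
    (X0 : [set: X] !=set0) (Y0 : [set: Y] !=set0) :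
  straight (l1prod X Y) <->
  [/\ straight X, straight Y &
      [\/ totally_bounded X /\ totally_bounded Y,
          ulc X /\ ulc Y |
          (totally_bounded X /\ ulc X) \/ (totally_bounded Y /\ ulc Y)]].
Proof.
have [x0 _] := X0; have [y0 _] := Y0; split.
  move=> /straight_uplaced XYu; have YXu := uplaced_swap XYu.
  split; [exact/uplaced_straight/(uplaced_prod_snd y0)
         |exact/uplaced_straight/(uplaced_prod_snd x0)|].
  have [Xtb|/(uplaced_prod_ulc XYu) Yl] := EM (totally_bounded X).
    have [Ytb|/(uplaced_prod_ulc YXu) Xl] := EM (totally_bounded Y).
      by apply: Or31.
    by apply: Or33; left.
  have [Ytb|/(uplaced_prod_ulc YXu) Xl] := EM (totally_bounded Y).
    by apply: Or33; right.
  by apply: Or32.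
move=> [/straight_uplaced Xu /straight_uplaced Yu cases].
apply: uplaced_straight.
case: cases => [[Xtb Ytb]|[Xl Yl]|[[Xtb Xl]|[Ytb Yl]]].
- exact: totally_bounded_prod_uplaced.
- exact: ulc_prod_uplaced.
- exact: totally_bounded_ulc_prod_uplaced.
- exact/uplaced_swap/totally_bounded_ulc_prod_uplaced.
Qed.
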